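(* Consider $n$ sporadic self-suspending tasks $\tau_1,\dots,\tau_n$ with constrained deadlines ($D_i\le T_i$), scheduled by preemptive fixed-priority scheduling on one processor, where $\tau_i$ has higher priority than $\tau_{i+1}$. Fix $k$ and assume that every higher-priority task $\tau_1,\dots,\tau_{k-1}$ meets its deadlines, i.e., its worst-case response time satisfies $R_i\le D_i$ for $1\le i\le k-1$. Let $\tau_k'$ be the task obtained from $\tau_k$ by converting its suspension into computation: $\tau_k'$ has period $T_k$, deadline $D_k$, no self-suspension, and worst-case execution time $C_k'=C_k+S_k>0$; consider the task set $\{\tau_1,\dots,\tau_{k-1},\tau_k',\tau_{k+1},\dots,\tau_n\}$. Let $b_i=\min(C_i,S_i)$ and $B_k=S_k+\sum_{i=1}^{k-1}b_i$. Let $R_k'>0$ be such that $C_k'+B_k+\sum_{i=1}^{k-1}\lceil R_k'/T_i\rceil C_i=R_k'$ and $C_k'+B_k+\sum_{i=1}^{k-1}\lceil t/T_i\rceil C_i>t$ for all $0<t<R_k'$. If the worst-case response time of $\tau_k'$ is not larger than $T_k$, then $R_k'$ is an upper bound on the worst-case response time of $\tau_k'$.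
   Context: A sporadic self-suspending task $\tau_i$ releases jobs with consecutive releases separated by at least $T_i$; the job released at $r_{i,j}$ has absolute deadline $r_{i,j}+D_i$. Each job executes for at most $C_i$ time units and suspends itself for at most $S_i$ time units in total (over all its suspension intervals); while a job is suspended the processor may execute other jobs. Successive jobs of the same task execute in sequence. Under preemptive fixed-priority scheduling, the processor always executes the highest-priority ready (released, unfinished, not suspended) job. The response time of a job is its finishing time minus release time; the worst-case response time of a task is the maximum over all its jobs (over all legal release patterns and suspension behaviours). *)

(* Defs.v *)
From mathcomp Require Import all_boot all_order all_algebra.
From mathcomp Require Import all_classical all_reals all_analysis.

Set Implicit Arguments.
Unset Strict Implicit.
Unset Printing Implicit Defensive.

Import Order.TTheory GRing.Theory Num.Theory.

Local Open Scope classical_set_scope.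
Local Open Scope ring_scope.
Local Open Scope ereal_scope.

Record task (R : realType) := Task {
  wcet : R;
  susp : R;
  period : R;
  deadline : R }.

Definition valid_task (R : realType) (tk : task R) : Prop :=
  [/\ (0 <= wcet tk)%R, (0 <= susp tk)%R & (0 < period tk)%R].

(** Tasks are indexed by ['I_n], a smaller index meaning a higher priority;
    the job [j] of task [i] is the pair [(i, j)].
    - [release i j] is [+oo] if task [i] releases at most [j] jobs.
    - [phases i j] is the list [:: (c_1, s_1); ...; (c_m, s_m)] of a job that
      executes for c_1, suspends for s_1, executes for c_2, suspends for s_2, ...
      A length may be 0, so a job may also start with a suspension, or end with
      a computation. The job is finished after its last phase; in particular a
      trailing suspension counts in its response time.
    - [sched t] is the job executed at time [t], if any. *)
Record run (R : realType) (n : nat) := Run {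
  release : 'I_n -> nat -> \bar R;
  phases : 'I_n -> nat -> seq (R * R);
  sched : R -> option ('I_n * nat) }.

Section Runs.
Context (R : realType) (n : nat).
Implicit Types (tau : 'I_n -> task R) (g : run R n) (i : 'I_n) (j : nat).

Definition exec_times g i j : set R := [set t | sched g t = Some (i, j)].

(** Time executed before [t]; nothing is released, hence executed, before 0. *)
Definition service g i j (t : R) : \bar R :=
  lebesgue_measure (`[0%R, t[%classic `&` exec_times g i j).

(** Earliest time, not before [s], at which [w] units of service have been
    received according to [srv]; [+oo] if there is none. *)
Definition served_at (srv : R -> \bar R) (s : \bar R) (w : R) : \bar R :=
  ereal_inf [set t%:E | t in [set t : R | s <= t%:E /\ w%:E <= srv t]].

(** The remaining phases [p] are entered at time [s], after [w] units of
    execution. *)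
Fixpoint phases_end (srv : R -> \bar R) (s : \bar R) (w : R) (p : seq (R * R))
    : \bar R :=
  if p is (c, d) :: p' then
    phases_end srv (served_at srv s (w + c)%R + d%:E) (w + c)%R p'
  else s.

Fixpoint phases_suspended (srv : R -> \bar R) (s : \bar R) (w : R)
    (p : seq (R * R)) (t : R) : Prop :=
  if p is (c, d) :: p' then
    let f := served_at srv s (w + c)%R in
    (f <= t%:E /\ t%:E < f + d%:E) \/
    phases_suspended srv (f + d%:E) (w + c)%R p' t
  else False.

(** A job starts its first phase when it is released and its predecessor is
    finished. *)
Fixpoint start g i j : \bar R :=
  if j is j'.+1 then
    maxe (release g i j)
         (phases_end (service g i j') (start g i j') 0%R (phases g i j'))
  else release g i 0.

Definition finish g i j : \bar R :=
  phases_end (service g i j) (start g i j) 0%R (phases g i j).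

Definition suspended g i j (t : R) : Prop :=
  phases_suspended (service g i j) (start g i j) 0%R (phases g i j) t.

Definition ready g i j (t : R) : Prop :=
  [/\ start g i j <= t%:E, t%:E < finish g i j & ~ suspended g i j t].

Definition legal_releases tau g : Prop := forall i j,
  0 <= release g i j /\
  release g i j + (period (tau i))%:E <= release g i j.+1.

Definition legal_phases tau g : Prop := forall i j,
  [/\ forall p, p \in phases g i j -> (0 <= p.1)%R /\ (0 <= p.2)%R,
      (\sum_(p <- phases g i j) p.1 <= wcet (tau i))%R
    & (\sum_(p <- phases g i j) p.2 <= susp (tau i))%R].

(** Jobs of a task run in sequence, so at most one of them is ready at a time
    and comparing the tasks is enough. *)
Definition fixed_priority g : Prop := forall t : R,
  match sched g t with
  | Some (i, j) =>
      ready g i j t /\ forall i' j', (i' < i)%N -> ~ ready g i' j' t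
  | None => forall i j, ~ ready g i j t
  end.

Definition legal tau g : Prop :=
  [/\ legal_releases tau g, legal_phases tau g,
      forall i j, measurable (exec_times g i j) & fixed_priority g].

(** [+oo] if response times are unbounded or if some released job never
    finishes. *)
Definition wcrt tau i : \bar R :=
  ereal_sup [set x | exists g j,
    [/\ legal tau g, release g i j < +oo & x = finish g i j - release g i j]].

Definition suspension_to_computation tau (k : 'I_n) : 'I_n -> task R :=
  fun i => if i == k then
    Task (wcet (tau k) + susp (tau k))%R 0%R (period (tau k)) (deadline (tau k))
  else tau i.

Definition blocking tau (k : 'I_n) : R :=
  (susp (tau k) +
   \sum_(i < n | (i < k)%N) Num.min (wcet (tau i)) (susp (tau i)))%R.

Definition interference tau (k : 'I_n) (t : R) : R :=
  (\sum_(i < n | (i < k)%N)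
     (Num.ceil (t / period (tau i)))%:~R * wcet (tau i))%R.

End Runs.

(* Main.v *)
(** Fix a job of the converted task, released at [r] and finished at [f]. It never
    suspends, so the processor serves it or a task of higher priority throughout
    [[r, f)]. Starting from [a = r], go through the higher-priority tasks from the
    lowest to the highest priority: if task [i] has a job pending at [a] and
    [susp <= wcet], move [a] back to the release of that job. On the added
    stretch the job is pending, so except for at most [susp] time units the
    processor serves tasks of priority at least [i]; moreover no earlier job of
    [i] is pending at the new [a]. If [wcet] is smaller, keep [a] and charge the
    carry-in job [wcet] instead. Either way task [i] costs an extra
    [min wcet susp] on top of its releases in the window, so at the end
    [t - a < Ck' + \sum_i (b_i + ceil ((t - a) / T_i) * C_i)] for all [t] in
    [[a, f)]. At [t = a + Rk'] this contradicts the fixed-point equation unless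
    [f <= a + Rk' <= r + Rk']. *)
Require Import Defs.
From mathcomp Require Import all_boot all_order all_algebra.
From mathcomp Require Import all_classical all_reals all_analysis.
From mathcomp Require Import lra zify.
Import Order.TTheory GRing.Theory Num.Theory.
Local Open Scope ring_scope.

Set Implicit Arguments.
Unset Strict Implicit.

(** * Upper bounds on Lebesgue outer measure *)

Section Covered.
Context (R : realType).
Implicit Types (A B : set R) (a b t x y : R).

(** Outer measure at most [x]; exact measurability is never needed. *)
Definition covered A x : Prop :=
  exists M : set R,
    [/\ measurable M, (A `<=` M)%classic & (lebesgue_measure M <= x%:E)%E].

Lemma covered0 : covered set0 0.
Proof. by exists set0; split => //; rewrite measure0. Qed.

Lemma covered_sub A B x : (A `<=` B)%classic -> covered B x -> covered A x.
Proof.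
by move=> AB [M [mM BM Mx]]; exists M; split => //; exact: subset_trans BM.
Qed.

Lemma covered_le A x y : x <= y -> covered A x -> covered A y.
Proof.
move=> xy [M [mM AM Mx]]; exists M; split => //.
by rewrite (le_trans Mx)// lee_fin.
Qed.

Lemma coveredU A B x y :
  covered A x -> covered B y -> covered (A `|` B)%classic (x + y).
Proof.
move=> [M [mM AM Mx]] [N [mN BN Ny]]; exists (M `|` N)%classic; split.
- exact: measurableU.
- exact: setUSS.
- by rewrite EFinD; apply: le_trans (measureU2 lebesgue_measure mM mN) _; rewrite leeD.
Qed.

Lemma covered_bigcup (F : nat -> set R) x (N : nat) :
  (forall m, covered (F m) x) ->
  covered (\bigcup_(m in [set m | (m < N)%N]) F m)%classic (N%:R * x).
Proof.
move=> Fx; elim: N => [|N IH].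
  by rewrite mul0r; apply: covered_sub covered0 => u [].
rewrite -natr1 mulrDl mul1r; apply: covered_sub (coveredU IH (Fx N)) => u [m /=].
rewrite ltnS leq_eqVlt => /orP[/eqP -> Fu|mN Fu]; first by right.
by left; exists m.
Qed.

(** Source of the inequalities on window lengths: a window is covered by suspension and execution,
    and its length is compared with the measure of the cover. *)
Lemma covered_itv a b x : a <= b -> covered `[a, b[%classic x -> b - a <= x.
Proof.
rewrite le_eqVlt => ab [M [mM abM Mx]].
suff : ((b - a)%:E <= x%:E)%E by rewrite lee_fin.
apply: le_trans Mx.
have : (lebesgue_measure `[a, b[%classic <= lebesgue_measure M)%E.
  by rewrite le_measure ?inE.
apply: le_trans; rewrite lebesgue_measure_itv/= lte_fin; case: ltP => //= ba.
by case/orP: ab => [/eqP ->|]; rewrite ?subrr ?ltNge ?ba.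
Qed.

Lemma itv_covered a b : a <= b -> covered `[a, b[%classic (b - a).
Proof.
move=> ab; exists `[a, b[%classic; split => //.
rewrite lebesgue_measure_itv/= lte_fin; case: ltP => // _.
by rewrite lee_fin subr_ge0.
Qed.

(** The measurable cover is cut at [a]. This divides an execution budget between two adjacent
    windows. *)
Lemma covered_split A x a : covered A x ->
  exists y z, [/\ y + z <= x, covered (A `&` [set u | u < a])%classic y
                & covered (A `&` [set u | a <= u])%classic z].
Proof.
move=> [M [mM AM Mx]].
pose L := (M `&` `]-oo, a[)%classic; pose U := (M `&` `[a, +oo[)%classic.
have mL : measurable L by exact: measurableI.
have mU : measurable U by exact: measurableI.
have LUM : (lebesgue_measure L + lebesgue_measure U <= x%:E)%E.
  apply: le_trans Mx; rewrite -measureU//.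
    rewrite le_measure ?inE//; first exact: measurableU.
    by rewrite /L /U -setIUr; apply: subIsetl.
  rewrite -subset0 => u [[_ /=]]; rewrite in_itv/= => ua [_ /=].
  by rewrite in_itv/= leNgt ua.
have L0 := measure_ge0 lebesgue_measure L.
have U0 := measure_ge0 lebesgue_measure U.
have Lfin : lebesgue_measure L \is a fin_num.
  by rewrite ge0_fin_numE// (le_lt_trans _ (ltry x))// (le_trans _ LUM)// leeDl.
have Ufin : lebesgue_measure U \is a fin_num.
  by rewrite ge0_fin_numE// (le_lt_trans _ (ltry x))// (le_trans _ LUM)// leeDr.
exists (fine (lebesgue_measure L)), (fine (lebesgue_measure U)); split.
- by rewrite -lee_fin EFinD !fineK.
- exists L; split => //; last by rewrite fineK.
  by move=> u [/AM Mu /= ua]; split => //=; rewrite in_itv.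
- exists U; split => //; last by rewrite fineK.
  by move=> u [/AM Mu /= au]; split => //=; rewrite in_itv/= au.
Qed.

End Covered.

(** * Progress of one job through its execution and suspension phases *)

Section Phases.
Context (R : realType) (srv : R -> \bar R).
Implicit Types (s : \bar R) (w t : R) (p : seq (R * R)).

Lemma served_at_le s w t :
  (s <= t%:E)%E -> (w%:E <= srv t)%E -> (served_at srv s w <= t%:E)%E.
Proof. by move=> st wt; apply: ereal_inf_lbound; exists t. Qed.

(** In the current phase, absence of suspension puts [t] before the infimum [served_at], so the
    service that completes this phase is not yet reached; later phases only enlarge the sum. *)
Lemma service_lt_phases s w p t :
  (forall q, q \in p -> 0 <= q.1 /\ 0 <= q.2) ->
  (s <= t%:E)%E -> (t%:E < phases_end srv s w p)%E ->
  ~ phases_suspended srv s w p t -> (srv t < (w + \sum_(q <- p) q.1)%:E)%E.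
Proof.
elim: p s w => [|[c d] p IH] s w /= p0 st tend nsusp.
  by move: (le_lt_trans st tend); rewrite ltxx.
have {}p0' q : q \in p -> 0 <= q.1 /\ 0 <= q.2.
  by move=> qp; apply: p0; rewrite inE qp orbT.
rewrite big_cons /= addrA.
have [tf|ft] := ltP t%:E (served_at srv s (w + c)).
  have : (srv t < (w + c)%:E)%E.
    rewrite ltNge; apply/negP => /(served_at_le st).
    by rewrite leNgt tf.
  move/lt_le_trans; apply; rewrite lee_fin lerDl big_seq_cond.
  by apply: sumr_ge0 => q /andP[/p0' []].
apply: (IH _ _ p0' _ tend); last by move=> h; apply: nsusp; right.
by rewrite leNgt; apply/negP => h; apply: nsusp; left.
Qed.

(** Each phase suspends on one interval [[f, f + d)], which is empty when [f] is infinite. *)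
Lemma covered_suspended s w p :
  (forall q, q \in p -> 0 <= q.1 /\ 0 <= q.2) ->
  covered [set t | phases_suspended srv s w p t]%classic (\sum_(q <- p) q.2).
Proof.
elim: p s w => [|[c d] p IH] s w p0 /=.
  by rewrite big_nil; exact: covered0.
have d0 : 0 <= d by have [] := p0 (c, d) (mem_head _ _).
have {}p0 q : q \in p -> 0 <= q.1 /\ 0 <= q.2.
  by move=> qp; apply: p0; rewrite inE qp orbT.
rewrite big_cons /=; set f := served_at _ _ _.
apply: (@coveredU _ [set t | f <= t%:E /\ t%:E < f + d%:E]%classic%E _ _ _ _) (IH _ _ p0).
case: f => [f| |].
- have ffd : f <= f + d by rewrite lerDl.
  have := itv_covered ffd; rewrite [f + d - f]addrC addKr; apply: covered_sub.
  by move=> t /= [ft]; rewrite -EFinD lte_fin in_itv/= -lee_fin ft.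
- by apply: (covered_le d0); apply: covered_sub (covered0 _) => t /= [].
- by apply: (covered_le d0); apply: covered_sub (covered0 _) => t /= [].
Qed.

(** With a zero suspension budget, [covered_suspended] only makes the suspensions negligible; this
    excludes them altogether. *)
Lemma suspended_gt0 s w p t :
  (forall q, q \in p -> 0 <= q.1 /\ 0 <= q.2) ->
  phases_suspended srv s w p t -> 0 < \sum_(q <- p) q.2.
Proof.
elim: p s w => [|[c d] p IH] s w p0 //=.
have d0 : 0 <= d by have [] := p0 (c, d) (mem_head _ _).
have {}p0 q : q \in p -> 0 <= q.1 /\ 0 <= q.2.
  by move=> qp; apply: p0; rewrite inE qp orbT.
rewrite big_cons /= => -[[ft tfd]|/(IH _ _ p0) sp]; last exact: ltr_wpDl.
apply: ltr_wpDr; first by rewrite big_seq_cond sumr_ge0// => q /andP[/p0 []].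
rewrite lt0r d0 andbT; apply/eqP => dE.
by move: (le_lt_trans ft tfd); rewrite dE adde0 ltxx.
Qed.

End Phases.

(** * Jobs and execution of a single task in a legal run *)

Section LegalRun.
Context (R : realType) (n : nat) (tau : 'I_n -> task R) (g : run R n).
Hypothesis g_legal : legal tau g.
Implicit Types (i : 'I_n) (j m : nat) (a b t u : R).

Lemma release_le_start i j : (release g i j <= start g i j)%E.
Proof. by case: j => //= j; rewrite le_max lexx. Qed.

Lemma sched_ready i j t : sched g t = Some (i, j) -> ready g i j t.
Proof. by have [_ _ _ /(_ t)] := g_legal; case: sched => // -[? ?] [] + _ [<- <-]. Qed.

Lemma service_lt_wcet i j t : (start g i j <= t%:E)%E ->
  (t%:E < finish g i j)%E -> ~ suspended g i j t ->
  (service g i j t < (wcet (tau i))%:E)%E.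
Proof.
have [_ /(_ i j) [p0 pC _] _ _] := g_legal.
move=> st tf ns; apply: lt_le_trans (service_lt_phases p0 st tf ns) _.
by rewrite lee_fin add0r.
Qed.

Lemma sched_window i j t : sched g t = Some (i, j) ->
  (release g i j <= t%:E)%E /\ (t%:E < finish g i j)%E.
Proof.
by move=> /sched_ready [st tf _]; split=> //; apply: le_trans st; exact: release_le_start.
Qed.

Lemma sched_ge0 i j t : sched g t = Some (i, j) -> 0 <= t.
Proof.
move=> /sched_window [rt _]; have [/(_ i j) [r0 _] _ _ _] := g_legal.
by rewrite -lee_fin (le_trans r0).
Qed.

(** At every instant [t] where a job executes, it has received less than its
    execution time so far; take [t] close to the supremum of these instants. *)
Lemma covered_exec i j b : 0 <= wcet (tau i) ->
  covered [set t | t < b /\ sched g t = Some (i, j)]%classic (wcet (tau i)).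
Proof.
move=> C0; set A := (X in covered X _).
have [_ _ mE _] := g_legal.
have [->|/set0P [t0 At0]] := eqVneq A set0.
  by apply: covered_le C0 (covered0 _).
have supA : has_sup A by split; [exists t0 | exists b => t [/ltW]].
pose M := (`[0, b[%classic `&` exec_times g i j)%classic.
have mM : measurable M by exact: measurableI.
exists M; split=> //.
- move=> t [tb st]; split=> //=.
  by rewrite in_itv/= tb (sched_ge0 st).
- apply/lee_addgt0Pr => e e0.
  have [t [tb st] et] := sup_adherent e0 supA.
  have [s1 s2 s3] := sched_ready st.
  pose U := (`[0, t[%classic `&` exec_times g i j)%classic.
  have mU : measurable U by exact: measurableI.
  have mI : measurable (`[t, sup A]%classic : set R) by exact: measurable_itv.
  have mIe : (lebesgue_measure (`[t, sup A]%classic : set R) <= e%:E)%E.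
    rewrite lebesgue_measure_itv/= lte_fin; case: ltP => ts.
      by rewrite -EFinB lee_fin; lra.
    by rewrite lee_fin ltW.
  have MU : (M `<=` U `|` `[t, sup A])%classic.
    move=> u [/=]; rewrite in_itv/= => /andP[u0 ub] su.
    have [ut|tu] := ltP u t; first by left; split=> //=; rewrite in_itv/= u0 ut.
    right; rewrite /= in_itv/= tu; apply: ub_le_sup; first by case: supA.
    by split.
  have le1 : (lebesgue_measure M <= lebesgue_measure (U `|` `[t, sup A])%classic)%E.
    by rewrite le_measure ?inE//; exact: measurableU.
  apply: (le_trans le1).
  apply: (le_trans (measureU2 lebesgue_measure mU mI)).
  apply: leeD; first exact: ltW (service_lt_wcet s1 s2 s3).
  exact: mIe.
Qed.

(** More than the in-sequence execution built into [start]: every job is over by the next release,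
    so [start] and [release] coincide. *)
Definition sequential i : Prop :=
  forall j, (finish g i j <= release g i j.+1)%E.

Lemma sequential_start i j : sequential i -> start g i j = release g i j.
Proof. by case: j => // j /(_ j) /max_idPl. Qed.

Lemma wcrt_sequential i :
  (wcrt tau i <= (period (tau i))%:E)%E -> sequential i.
Proof.
move=> wi j; have [/(_ i j) [r0 rT] _ _ _] := g_legal.
have [rf|] := boolP (release g i j < +oo)%E; last first.
  (* If job [j] is never released, neither is job [j.+1], so the bound is [+oo]. *)
  by rewrite ltey negbK => /eqP rE; move: rT; rewrite rE addye// => /(le_trans (leey _)).
apply: le_trans rT.
have rfin : release g i j \is a fin_num by rewrite ge0_fin_numE.
rewrite addeC -leeBlDr//; apply: le_trans wi.
by apply: ereal_sup_ubound; exists g, j.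
Qed.

Lemma release_add i j m :
  (release g i j + (m%:R * period (tau i))%:E <= release g i (j + m))%E.
Proof.
elim: m => [|m IH]; first by rewrite mul0r adde0 addn0.
have [/(_ i (j + m)%N) [_ rT] _ _ _] := g_legal.
rewrite addnS; apply: le_trans rT.
by rewrite -natr1 mulrDl mul1r EFinD addeA leeD.
Qed.

Lemma release_mono i j j' : 0 <= period (tau i) -> (j <= j')%N ->
  (release g i j <= release g i j')%E.
Proof.
move=> T0 /subnKC <-; apply: le_trans (release_add i j (j' - j)).
by rewrite leeDl// lee_fin mulr_ge0.
Qed.

Definition pending i j a : Prop :=
  (release g i j < a%:E)%E /\ (a%:E < finish g i j)%E.

Definition carry i a : R := (`[< exists j, pending i j a >])%:R.

(** [j0] is the first job of task [i] executed in the window. If it is released at or after [a], the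
    spacing of releases bounds the count. Otherwise it is the carry-in job; job [j0.+1] is released
    after [a], so counting from there costs one more. *)
Lemma sched_jobs i a t : 0 < period (tau i) -> sequential i ->
  exists j0, forall u j, a <= u -> u < t -> sched g u = Some (i, j) ->
    exists m, j = (j0 + m)%N /\
      m%:R < (Num.ceil ((t - a) / period (tau i)))%:~R + carry i a.
Proof.
move=> T0 seqi; set T := period (tau i) in T0 *.
pose P j := `[< exists u, [/\ a <= u, u < t & sched g u = Some (i, j)] >].
have [exP|noP] := pselect (exists j, P j); last first.
  by exists 0%N => u j au ut su; case: noP; exists j; apply/asboolP; exists u.
exists (ex_minn exP) => u j au ut su; case: ex_minnP => j0 /asboolP.
move=> [u0 [au0 u0t /sched_window [r0 f0]]] j0min.
have /j0min jj : P j by apply/asboolP; exists u.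
exists (j - j0)%N; split; first by rewrite subnKC.
have [rj _] := sched_window su.
have af0 : (a%:E < finish g i j0)%E by apply: le_lt_trans f0; rewrite lee_fin.
have ceil_lt m : a + m%:R * T < t -> m%:R < (Num.ceil ((t - a) / T))%:~R :> R.
  move=> mt; rewrite -[m%:R]/(m%:Z%:~R) ltr_int ceil_gt_int ltr_pdivlMr//.
  by rewrite -[m%:Z%:~R]/(m%:R); lra.
have late l m : (a%:E <= release g i l)%E -> (release g i (l + m) <= u%:E)%E ->
    m%:R < (Num.ceil ((t - a) / T))%:~R :> R.
  move=> al lu; apply: ceil_lt; apply: le_lt_trans ut; rewrite -lee_fin.
  by apply: le_trans lu; apply: le_trans (release_add i l m); rewrite EFinD leeD.
have [ar|ra] := leP a%:E (release g i j0).
  apply: ltr_wpDr; first by rewrite /carry ler0n.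
  by apply: late ar _; rewrite subnKC.
have -> : carry i a = 1 by rewrite /carry asboolT//; exists j0.
have [jE|jne] := eqVneq j j0.
  rewrite jE subnn; apply: ltr_wpDl => //; rewrite ler0z ceil_ge0.
  by apply: (@lt_le_trans _ _ 0) => //; rewrite divr_ge0 ?ltW//; lra.
have jE : (j0.+1 + (j - j0).-1)%N = j by lia.
rewrite (_ : j - j0 = (j - j0).-1.+1)%N; last by lia.
rewrite -natr1 ltrD2r; apply: (late j0.+1); last by rewrite jE.
by apply: le_trans (seqi j0); exact: ltW.
Qed.

Lemma covered_task_exec i a t : valid_task (tau i) -> sequential i -> a <= t ->
  covered [set u | [/\ a <= u, u < t & exists j, sched g u = Some (i, j)]]%classic
    (((Num.ceil ((t - a) / period (tau i)))%:~R + carry i a) * wcet (tau i)).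
Proof.
move=> [C0 _ T0] seqi at_; have [j0 j0P] := sched_jobs a t T0 seqi.
set c := Num.ceil _ in j0P *.
have c0 : 0 <= c.
  rewrite ceil_ge0; apply: (@lt_le_trans _ _ 0) => //.
  by rewrite divr_ge0 ?subr_ge0// ltW.
pose N := (`|c| + `[< exists j, pending i j a >])%N.
have NE : N%:R = c%:~R + carry i a :> R.
  by rewrite natrD natr_absz ger0_norm.
rewrite -NE in j0P *.
pose F m := [set u | u < t /\ sched g u = Some (i, (j0 + m)%N)]%classic.
apply: covered_sub (@covered_bigcup R F _ N _); last by move=> m; exact: covered_exec.
move=> u /= [au ut [j su]]; have [m [jE mN]] := j0P u j au ut su.
by exists m => /=; [rewrite -(ltr_nat R)|split=> //; rewrite su jE].
Qed.

End LegalRun.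

(** * Extension of the busy window through the higher-priority tasks *)

Section BusyWindow.
Context (R : realType) (n : nat) (tau : 'I_n -> task R) (g : run R n).
Hypothesis tau_valid : forall i, valid_task (tau i).
Hypothesis g_legal : legal tau g.
Implicit Types (i : 'I_n) (j l m : nat) (a b t u h x : R).

Lemma period_ge0 i : 0 <= period (tau i).
Proof. by have [_ _ /ltW] := tau_valid i. Qed.

(** Under [sequential], the intervals from release to finish of distinct jobs are disjoint. *)
Lemma sched_unique i j j' u : sequential g i ->
  (release g i j <= u%:E)%E -> (u%:E < finish g i j)%E ->
  sched g u = Some (i, j') -> j' = j.
Proof.
move=> seqi ru uf /(sched_window g_legal) [ru' uf'].
have disj j1 j2 : (release g i j2 <= u%:E)%E -> (u%:E < finish g i j1)%E -> ~~ (j1 < j2)%N.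
  move=> r2 f1; apply/negP => /(release_mono g_legal (period_ge0 i)) r12.
  have := le_lt_trans (le_trans (seqi j1) (le_trans r12 r2)) f1.
  by rewrite ltxx.
by have := disj _ _ ru uf'; have := disj _ _ ru' uf; lia.
Qed.

(** Makes [carry] vanish at a release of task [i]: earlier jobs have finished, and the others are
    not released before [a]. *)
Lemma not_pending_at_release i j a j' : sequential g i ->
  release g i j = a%:E -> ~ pending g i j' a.
Proof.
move=> seqi ra [ra' af]; have [jj|jj] := leqP j j'.
  have := release_mono g_legal (period_ge0 i) jj.
  by rewrite ra leNgt ra'.
have := le_trans (seqi j') (release_mono g_legal (period_ge0 i) jj).
by rewrite ra leNgt af.
Qed.

Definition higher_exec l a t : set R :=
  [set u | [/\ a <= u, u < t & exists i j, (i < l)%N /\ sched g u = Some (i, j)]]%classic.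

Lemma ready_sched i j u : ready g i j u ->
  exists i' j', (i' <= i)%N /\ sched g u = Some (i', j').
Proof.
have [_ _ _ /(_ u)] := g_legal; case: sched => [[i' j'] [_ no]|no] rdy.
  by exists i', j'; split=> //; rewrite leqNgt; apply/negP => /(no _ j).
by case: (no i j).
Qed.

Lemma covered_higher_execS i a t h : sequential g i -> a <= t ->
  covered (higher_exec i a t) h ->
  covered (higher_exec i.+1 a t)
    (h + ((Num.ceil ((t - a) / period (tau i)))%:~R + carry g i a) * wcet (tau i)).
Proof.
move=> seqi at_ ch.
apply: covered_sub (coveredU ch (covered_task_exec g_legal (tau_valid i) seqi at_)).
move=> u [au ut [i' [j [ii su]]]].
have [iE|ne] := eqVneq i' i; first by right; split=> //; exists j; rewrite su iE.
left; split=> //; exists i', j; split=> //.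
by rewrite ltn_neqAle ne -ltnS.
Qed.

(** At every instant of the window, job [j] either is suspended or is ready, and then a task of
    priority at least that of [i] executes. *)
Lemma pending_window i j a t h : sequential g i -> release g i j = a%:E ->
  a <= t -> (t%:E <= finish g i j)%E -> covered (higher_exec i.+1 a t) h ->
  t - a <= susp (tau i) + h.
Proof.
move=> seqi ra at_ tf ch.
have [_ /(_ i j) [p0 _ pS] _ _] := g_legal.
have cs := covered_suspended (service g i j) (start g i j) 0 p0.
apply: covered_itv at_ _; apply: covered_sub (coveredU (covered_le pS cs) ch).
move=> u; rewrite /= in_itv/= => /andP[au ut].
have [su|nsu] := pselect (suspended g i j u); [by left|right; split=> //].
have [|i' [j' [ii su]]] := @ready_sched i j u; last by exists i', j'.
split=> //; first by rewrite sequential_start// ra lee_fin.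
by apply: lt_le_trans tf; rewrite lte_fin.
Qed.

(** The contribution of one higher-priority task to the fixed-point equation: its [b_i] plus its
    interference. *)
Definition demand (tk : task R) x : R :=
  Num.min (wcet tk) (susp tk) + (Num.ceil (x / period tk))%:~R * wcet tk.

Lemma le_demand i x y : x <= y -> demand (tau i) x <= demand (tau i) y.
Proof.
move=> xy; have [C0 _ T0] := tau_valid i.
by rewrite lerD2l ler_wpM2r// ler_int le_ceil// ler_pM2r// invr_gt0.
Qed.

Lemma demand_ge0 i x : 0 <= x -> 0 <= demand (tau i) x.
Proof.
move=> x0; have [C0 S0 T0] := tau_valid i.
rewrite addr_ge0 ?le_min ?C0// mulr_ge0// ler0z ceil_ge0.
by apply: (@lt_le_trans _ _ 0) => //; rewrite divr_ge0// ltW.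
Qed.

Context (k : 'I_n) (j : nat) (r : R).
Hypothesis sequential_le : forall i, (i <= k)%N -> sequential g i.
Hypothesis no_susp : susp (tau k) = 0.
Hypothesis wcet_gt0 : 0 < wcet (tau k).
Hypothesis release_r : release g k j = r%:E.

(** Induction invariant: tasks [l] to [k - 1] are already charged by [demand], those of index below
    [l] still by a bound [h] on their actual execution. *)
Definition window_bound l a : Prop :=
  forall t h, a <= t -> (t%:E < finish g k j)%E ->
  covered (higher_exec l a t) h ->
  t - a < wcet (tau k) + \sum_(i < n | (l <= i < k)%N) demand (tau i) (t - a) + h.

(** The job never suspends, so throughout [[r, t)] either it or a higher-priority task executes. The
    inequality is strict because the job is unfinished at [t]: its service is still below
    [wcet (tau k)]. *)
Lemma window_bound_release : window_bound k r.
Proof.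
move=> t h rt tf ch; have seqk := sequential_le (leqnn k).
rewrite big_pred0; last by move=> i; case: ltngtP.
have [_ /(_ k j) [p0 _ pS] mE _] := g_legal.
have nsusp u : ~ suspended g k j u.
  by move=> /(suspended_gt0 p0); move: pS; rewrite no_susp ltNge => ->.
have st u : r <= u -> (start g k j <= u%:E)%E.
  by rewrite sequential_start// release_r lee_fin.
have srv0 : (0 <= service g k j t)%E by exact: measure_ge0.
have mI : measurable (`[0, t[ `&` exec_times g k j)%classic by exact: measurableI.
have := service_lt_wcet g_legal (st _ rt) tf (@nsusp t).
case srvE : (service g k j t) srv0 => [c| |] // _.
rewrite lte_fin => cC; rewrite addr0.
suff : t - r <= c + h by lra.
have cc : covered (`[0, t[ `&` exec_times g k j)%classic c.
  by exists (`[0, t[ `&` exec_times g k j)%classic; split=> //; rewrite -srvE.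
apply: covered_itv rt _; apply: covered_sub (coveredU cc ch) => u.
rewrite /= in_itv/= => /andP[ru ut].
have uf : (u%:E < finish g k j)%E by apply: lt_trans tf; rewrite lte_fin.
have [i [j' [ik su]]] : exists i j', (i <= k)%N /\ sched g u = Some (i, j').
  by apply: (@ready_sched k j); split=> //; exact: st.
have [iE|ne] := eqVneq i k; last first.
  by right; split=> //; exists i, j'; split=> //; rewrite ltn_neqAle ne.
left; rewrite iE in su; split; first by rewrite /= in_itv/= ut (sched_ge0 g_legal su).
by rewrite /exec_times/= su (sched_unique seqk _ uf su)// release_r lee_fin.
Qed.

(** If the carry-in job of task [i] may execute longer than it may suspend, the
    window is extended to the left up to its release. *)
Lemma window_bound_step i a : (i < k)%N -> window_bound i.+1 a ->
  exists2 a', a' <= a & window_bound i a'.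
Proof.
move=> ik wb; have [C0 S0 T0] := tau_valid i.
have seqi := sequential_le (ltnW ik).
have sumE x : \sum_(l < n | (i <= l < k)%N) demand (tau l) x =
    demand (tau i) x + \sum_(l < n | (i.+1 <= l < k)%N) demand (tau l) x.
  rewrite (bigD1 i) ?leqnn//=; congr (_ + _); apply: eq_bigl => l.
  by rewrite -val_eqE /=; lia.
(* Cheap case: the carry-in charge fits in [min wcet susp], and [a] stays. *)
have [cb|cb] := leP (carry g i a * wcet (tau i)) (Num.min (wcet (tau i)) (susp (tau i))).
  exists a => // t h at_ tf /(covered_higher_execS seqi at_) /(wb _ _ at_ tf).
  by rewrite sumE /demand mulrDl; lra.
have [[jc [ra af]]|np] := pselect (exists jc, pending g i jc a); last first.
  by move: cb; rewrite /carry asboolF// mul0r ltNge le_min C0 S0.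
have SC : susp (tau i) <= wcet (tau i).
  move: cb; rewrite /carry asboolT; last by exists jc.
  by rewrite mul1r gt_min ltxx/= => /ltW.
have [a' aE] : exists a', release g i jc = a'%:E.
  have [/(_ i jc) [r0 _] _ _ _] := g_legal.
  by move: ra r0; case: (release g i jc) => [a'| |] //; exists a'.
rewrite aE lte_fin in ra; exists a'; first exact: ltW.
move=> t h a't tf ch.
have := covered_higher_execS seqi a't ch.
have -> : carry g i a' = 0.
  by rewrite /carry asboolF// => -[j']; exact: not_pending_at_release aE.
rewrite addr0; set w := _ * _ => cw.
rewrite sumE {1}/demand min_r// -/w; move: w cw => w cw.
(* Inside the added stretch the pending carry-in job suffices, and [wcet_gt0] makes the inequality
   strict. *)
have [ta|a_t] := leP t a.
  have s0 : 0 <= \sum_(l < n | (i.+1 <= l < k)%N) demand (tau l) (t - a').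
    by apply: sumr_ge0 => l _; apply: demand_ge0; lra.
  suff : t - a' <= susp (tau i) + (h + w). by have := wcet_gt0; lra.
  apply: (pending_window seqi aE a't _ cw).
  by apply: le_trans (ltW af); rewrite lee_fin.
(* Beyond [a], the budget is split at [a]: the left share goes to [pending_window] on [[a', a)], the
   right share to the previous bound on [[a, t)]. *)
have [y [z [yz cy cz]]] := covered_split a cw.
have cy' : covered (higher_exec i.+1 a' a) y.
  apply: covered_sub cy => u [a'u ua ex]; split=> //; split=> //.
  exact: lt_trans a_t.
have cz' : covered (higher_exec i.+1 a t) z.
  apply: covered_sub cz => u [au ut ex]; split=> //; split=> //.
  exact: le_trans (ltW ra) au.
have w1 := pending_window seqi aE (ltW ra) (ltW af) cy'.
have w2 := wb t z (ltW a_t) tf cz'.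
have s12 : \sum_(l < n | (i.+1 <= l < k)%N) demand (tau l) (t - a) <=
    \sum_(l < n | (i.+1 <= l < k)%N) demand (tau l) (t - a').
  by apply: ler_sum => l _; apply: le_demand; lra.
by lra.
Qed.

(** The index descends from [k] to 0, where no higher-priority task is left and [h = 0] is
    admissible. *)
Lemma busy_window : exists2 a, a <= r &
  forall t, a <= t -> (t%:E < finish g k j)%E ->
  t - a < wcet (tau k) + \sum_(i < n | (i < k)%N) demand (tau i) (t - a).
Proof.
have ext m : (m <= k)%N -> exists2 a, a <= r & window_bound (k - m) a.
  elim: m => [_|m IH mk].
    by exists r => //; rewrite subn0; exact: window_bound_release.
  have [a ar wb] := IH (ltnW mk).
  have lt_n : (k - m.+1 < n)%N by apply: leq_ltn_trans (ltn_ord k); exact: leq_subr.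
  have lt_k : (Ordinal lt_n < k)%N by rewrite /=; lia.
  have := @window_bound_step (Ordinal lt_n) a lt_k; rewrite /= subnSK// => /(_ wb).
  by move=> [a' a'a wb']; exists a' => //; exact: le_trans ar.
have [a ar wb] := ext k (leqnn k); exists a => // t at_ tf.
have := wb t 0 at_ tf; rewrite subnn addr0; apply.
by apply: covered_sub (covered0 _) => u [_ _ [i [? []]]].
Qed.

End BusyWindow.

(** The higher-priority tasks behave the same in [g] and in [keep_higher g k], and
    the latter is legal even if task [k] was modified: this transfers the deadline
    hypotheses on the original task set to runs of the converted one. *)
Section KeepHigher.
Context (R : realType) (n : nat) (g : run R n) (k : nat).
Implicit Types (i : 'I_n) (j : nat) (t : R).

(** A release at [+oo] silences a task, since its jobs are then never ready; instants where [g]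
    executes such a task become idle. *)
Definition keep_higher : run R n := Run
  (fun i j => if (i < k)%N then release g i j else +oo%E)
  (fun i j => if (i < k)%N then phases g i j else [::])
  (fun t => if sched g t is Some (i, j) then
              if (i < k)%N then Some (i, j) else None
            else None).

Lemma exec_times_keep_higher i j :
  exec_times keep_higher i j = if (i < k)%N then exec_times g i j else set0.
Proof.
apply/seteqP; rewrite /exec_times; case: ifPn => ik; split=> t //=;
  case: (sched g t) => [[i' j']|] //.
- by case: ifP => // _ [-> ->].
- by move=> [-> ->]; rewrite ik.
- by case: ifPn => // ik' [iE _]; rewrite iE (negbTE ik) in ik'.
Qed.

Lemma service_keep_higher i j : (i < k)%N ->
  service keep_higher i j = service g i j.
Proof.
by move=> ik; apply/funext => t; rewrite /service exec_times_keep_higher ik.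
Qed.

Lemma start_keep_higher i j : (i < k)%N -> start keep_higher i j = start g i j.
Proof.
move=> ik; elim: j => [|j IH] /=; rewrite ik//.
by rewrite IH service_keep_higher.
Qed.

Lemma finish_keep_higher i j : (i < k)%N -> finish keep_higher i j = finish g i j.
Proof.
by move=> ik; rewrite /finish start_keep_higher// service_keep_higher//= ik.
Qed.

Lemma ready_keep_higher i j t :
  ready keep_higher i j t <-> (i < k)%N /\ ready g i j t.
Proof.
have [ik|ik] := boolP (i < k)%N.
  rewrite /ready finish_keep_higher// /suspended service_keep_higher//.
  by rewrite start_keep_higher//= ik; split=> [|[]].
split=> [[st _ _]|[]//]; have := le_trans (release_le_start keep_higher i j) st.
by rewrite /= (negbTE ik).
Qed.

Lemma legal_keep_higher (tau tau' : 'I_n -> task R) :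
  (forall i, (i < k)%N -> tau' i = tau i) -> (forall i, valid_task (tau i)) ->
  legal tau' g -> legal tau keep_higher.
Proof.
move=> tauE valid [rel pha mE fp]; split.
- move=> i j /=; case: ifPn => ik; first by rewrite -tauE.
  by rewrite addye// leey.
- move=> i j /=; case: ifPn => ik; first by rewrite -tauE.
  by have [C0 S0 _] := valid i; rewrite !big_nil.
- by move=> i j; rewrite exec_times_keep_higher; case: ifP.
- move=> t; have := fp t; rewrite /=.
  case: (sched g t) => [[i j]|] /=.
    move=> [rdy no]; case: ifPn => ik.
      split; first exact/ready_keep_higher.
      by move=> i' j' ii /ready_keep_higher [_]; exact: no.
    (* This instant is now idle; [g] executed a task of index at least [k] here, so no task of
       smaller index than [k] was ready. *)
    move=> i' j' /ready_keep_higher [ik']; apply: no.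
    by apply: leq_trans ik' _; rewrite leqNgt.
  by move=> no i j /ready_keep_higher [_]; exact: no.
Qed.

End KeepHigher.

Theorem theorem1 (R : realType) (n : nat) (tau : 'I_n -> task R) (k : 'I_n)
  (tau_valid : forall i, valid_task (tau i))
  (constrained : forall i, deadline (tau i) <= period (tau i))
  (higher_meet : forall i : 'I_n, (i < k)%N ->
     (wcrt tau i <= (deadline (tau i))%:E)%E)
  (Ck' : R) (Ck'E : Ck' = wcet (tau k) + susp (tau k)) (Ck'_gt0 : 0 < Ck')
  (Rk' : R) (Rk'_gt0 : 0 < Rk')
  (Rk'_fix : Ck' + blocking tau k + interference tau k Rk' = Rk')
  (Rk'_least : forall t : R, 0 < t -> t < Rk' ->
     t < Ck' + blocking tau k + interference tau k t)
  (wcrt_le_period :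
     (wcrt (suspension_to_computation tau k) k <= (period (tau k))%:E)%E) :
  (wcrt (suspension_to_computation tau k) k <= Rk'%:E)%E.
Proof.
set tau' := suspension_to_computation tau k in wcrt_le_period *.
have tau'k : tau' k = Task Ck' 0 (period (tau k)) (deadline (tau k)).
  by rewrite /tau' /suspension_to_computation eqxx Ck'E.
have tau'E (i : 'I_n) : (i < k)%N -> tau' i = tau i.
  by move=> ik; rewrite /tau' /suspension_to_computation -val_eqE ltn_eqF.
have tau'_valid i : valid_task (tau' i).
  have [->|ne] := eqVneq i k; last by rewrite /tau' /suspension_to_computation (negbTE ne).
  by rewrite tau'k; have [_ _ T0] := tau_valid k; split=> //=; exact: ltW.
apply: ge_ereal_sup => _ [g [j [g_legal rfin ->]]].
(* For task [k] this is [wcrt_le_period]. The others meet their deadlines, hence their periods, in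
   [keep_higher g k], which is legal for [tau] and gives them the same finishing times. *)
have seq (i : 'I_n) : (i <= k)%N -> sequential g i.
  rewrite leq_eqVlt => /orP[/eqP/val_inj ->|ik].
    by apply: (wcrt_sequential g_legal); rewrite tau'k.
  move=> l; have := legal_keep_higher tau'E tau_valid g_legal.
  move=> /wcrt_sequential /(_ i _ l); rewrite finish_keep_higher//= ik; apply.
  by apply: (le_trans (higher_meet _ ik)); rewrite lee_fin.
have [r rE] : exists r, release g k j = r%:E.
  have [/(_ k j) [r0 _] _ _ _] := g_legal.
  by move: rfin r0; case: (release g k j) => [r| |] //; exists r.
have [a ar bw] : exists2 a, a <= r & forall t, a <= t ->
    (t%:E < finish g k j)%E -> t - a < wcet (tau' k) +
      \sum_(i < n | (i < k)%N) demand (tau' i) (t - a).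
  by apply: busy_window => //; rewrite tau'k.
(* A job finishing after [r + Rk'] is unfinished at [a + Rk'], as [a <= r]; so [bw] applies at that
   instant. *)
rewrite rE leeBlDr// -EFinD leNgt; apply/negP => Rf.
have aR : ((a + Rk')%:E < finish g k j)%E.
  by apply: le_lt_trans Rf; rewrite lee_fin; lra.
have := bw _ _ aR; rewrite lerDl ltW// => /(_ isT).
rewrite addrAC subrr add0r tau'k /=.
under eq_bigr => i ik do rewrite tau'E//.
rewrite big_split /= -/(interference tau k Rk').
(* [bw] now reads [Rk' < Ck' + \sum_i b_i + interference tau k Rk']; adding [susp (tau k) >= 0] on
   the right gives [Rk' < Rk']. *)
move: Rk'_fix; rewrite /blocking; have [_ S0 _] := tau_valid k.
by lra.
Qed.
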